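(* The following are equivalent for an integral domain $D$: (1) $D$ is a $\ast$-super SH domain, i.e. for every nonzero nonunit $x$ of $D$, $xD$ is a $\ast$-product of finitely many $\ast$-super homog ideals; (2) $D$ is a $\ast$-IRKT.
   Context: $\ast$ is a star operation on $D$ of finite character. A $\ast$-ideal is a nonzero fractional ideal $I$ with $I^\ast=I$; it is of finite type if $I=J^\ast$ for some nonzero finitely generated $J$. A maximal $\ast$-ideal is an integral $\ast$-ideal maximal among proper integral $\ast$-ideals. A nonzero fractional ideal $I$ is $\ast$-invertible if $(II^{-1})^\ast=D$. The $\ast$-product of $I_1,\dots,I_n$ is $(I_1\cdots I_n)^\ast$. A nonzero proper integral $\ast$-ideal $I$ of finite type is $\ast$-super homog if (1) every $\ast$-ideal of finite type containing $I$ is $\ast$-invertible, and (2) $(A+B)^\ast\neq D$ for every pair $A,B$ of proper integral $\ast$-ideals of finite type containing $I$. $D$ is a $\ast$-IRKT ($\ast$-independent ring of Krull type) if (i) $D_P$ is a valuation domain for every maximal $\ast$-ideal $P$, (ii) $D=\bigcap D_P$ over all maximal $\ast$-ideals $P$ with the intersection locally finite (each nonzero element lies in only finitely many maximal $\ast$-ideals), and (iii) no two distinct maximal $\ast$-ideals contain a common nonzero prime ideal. *)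

(* Defs.v *)
(* An integral domain D is modelled as a subring D of a
   field K which is its quotient field; fractional ideals are D-submodules
   of K, represented as predicates K -> Prop (compared with Leibniz
   equality, which is extensional equality up to the whitelisted
   functional/propositional extensionality axioms). *)
From HB Require Import structures.
From Stdlib Require List.
From mathcomp Require Import all_boot all_order all_algebra.
Set Implicit Arguments. Unset Strict Implicit. Unset Printing Implicit Defensive.
Import GRing.Theory.
Local Open Scope ring_scope.

Definition kset (K : Type) := K -> Prop.

Section Defs.
Variables (K : fieldType) (D : kset K).

Definition subs (A B : kset K) : Prop := forall x, A x -> B x.

Definition is_subring : Prop :=
  D 0 /\ D 1 /\ (forall a b, D a -> D b -> D (a - b)) /\
  (forall a b, D a -> D b -> D (a * b)).

Definition is_quotient_field : Prop :=
  forall x : K, exists a b, D a /\ D b /\ b != 0 /\ x = a / b.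

Definition submodule (I : kset K) : Prop :=
  I 0 /\ (forall a b, I a -> I b -> I (a + b)) /\
  (forall d a, D d -> I a -> I (d * a)).

Definition fractional (I : kset K) : Prop :=
  submodule I /\ (exists x, I x /\ x != 0) /\
  (exists d, D d /\ d != 0 /\ forall x, I x -> D (d * x)).

Definition gen (A : kset K) : kset K :=
  fun y => forall S, submodule S -> subs A S -> S y.

Definition fin_gen (J : kset K) : Prop :=
  exists s : seq K, J = gen (fun x => x \in s).

Definition prin (x : K) : kset K := fun y => exists d, D d /\ y = d * x.

Definition mulset (x : K) (I : kset K) : kset K :=
  fun y => exists z, I z /\ y = x * z.

Definition iprod (I J : kset K) : kset K :=
  gen (fun y => exists a b, I a /\ J b /\ y = a * b).

Definition isum (I J : kset K) : kset K :=
  fun y => exists a b, I a /\ J b /\ y = a + b.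

Definition iinv (I : kset K) : kset K := fun x => forall y, I y -> D (x * y).

Definition star_operation (star : kset K -> kset K) : Prop :=
  (forall I, fractional I -> fractional (star I)) /\
  (forall x, x != 0 -> star (prin x) = prin x) /\
  (forall x I, x != 0 -> fractional I -> star (mulset x I) = mulset x (star I)) /\
  (forall I, fractional I -> subs I (star I)) /\
  (forall I J, fractional I -> fractional J -> subs I J -> subs (star I) (star J)) /\
  (forall I, fractional I -> star (star I) = star I).

Definition finite_character (star : kset K -> kset K) : Prop :=
  forall I, fractional I ->
    star I = (fun x => exists J, fin_gen J /\ (exists y, J y /\ y != 0) /\
                                 subs J I /\ star J x).

Section Star.
Variable star : kset K -> kset K.

Definition star_ideal (I : kset K) : Prop := fractional I /\ star I = I.

Definition finite_type (I : kset K) : Prop :=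
  exists J, fin_gen J /\ (exists y, J y /\ y != 0) /\ I = star J.

Definition proper_integral (I : kset K) : Prop := subs I D /\ I <> D.

Definition maximal_star_ideal (P : kset K) : Prop :=
  star_ideal P /\ proper_integral P /\
  forall Q, star_ideal Q -> proper_integral Q -> subs P Q -> Q = P.

Definition star_invertible (I : kset K) : Prop :=
  fractional I /\ star (iprod I (iinv I)) = D.

Definition star_product (ls : seq (kset K)) : kset K :=
  star (foldr iprod D ls).

Definition star_super_homog (I : kset K) : Prop :=
  star_ideal I /\ finite_type I /\ proper_integral I /\
  (forall J, star_ideal J -> finite_type J -> subs I J -> star_invertible J) /\
  (forall A B, star_ideal A -> finite_type A -> proper_integral A -> subs I A ->
               star_ideal B -> finite_type B -> proper_integral B -> subs I B ->
               star (isum A B) <> D).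

Definition star_super_SH : Prop :=
  forall x, D x -> x != 0 -> ~ D x^-1 ->
    exists ls : seq (kset K),
      (forall I, List.In I ls -> star_super_homog I) /\
      prin x = star_product ls.

Definition localization (P : kset K) : kset K :=
  fun y => exists a s, D a /\ D s /\ ~ P s /\ y = a / s.

Definition valuation_domain (V : kset K) : Prop :=
  forall x : K, x != 0 -> V x \/ V x^-1.

Definition nonzero_prime_ideal (R : kset K) : Prop :=
  submodule R /\ proper_integral R /\ (exists y, R y /\ y != 0) /\
  (forall a b, D a -> D b -> R (a * b) -> R a \/ R b).

Definition star_IRKT : Prop :=
  (forall P, maximal_star_ideal P -> valuation_domain (localization P)) /\
  (forall x, D x <-> (forall P, maximal_star_ideal P -> localization P x)) /\
  (forall x, D x -> x != 0 ->
     exists ls : seq (kset K),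
       forall P, maximal_star_ideal P -> P x -> List.In P ls) /\
  (forall P Q R, maximal_star_ideal P -> maximal_star_ideal Q -> P <> Q ->
     nonzero_prime_ideal R -> subs R P -> subs R Q -> False).

End Star.
End Defs.

(* Main.v *)
(* (1) => (2).  A super homog ideal [I] lies in a unique maximal star ideal: for two of them
   [P <> Q], [(P + Q)^* = D] lets one enlarge [I] into finite type ideals [A <= P], [B <= Q]
   with [(A + B)^* = D].  At a maximal [M], every [(d, I)^*] is star invertible, hence
   generated in D_M by one of its generators; writing [b D = (I_1 ... I_n)^*] this makes
   D_M a valuation ring, and every prime containing [b] contains some [I_i], which gives
   local finiteness and independence.
   (2) => (1).  Let [P_1, ..., P_n] be the maximal star ideals containing [x].
   Independence yields, for [i <> j], [y_ij] in [D \ P_i] with [y_ij / x] in D_(P_j) (else the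
   radical of [x D_(P_j)] would be a prime inside [P_i] and [P_j]).  Then
   [I_j = (x, y_1j, ..., y_nj)^*] lies in [P_j] only, finite type star ideals are star
   invertible since each D_P is a valuation ring, so [I_j] is super homog, and
   [(I_1 ... I_n)^* = x D] is checked at each maximal star ideal. *)

Require Import Defs.
From HB Require Import structures.
From mathcomp Require Import all_boot all_order all_algebra.
From mathcomp Require Import ring.
From mathcomp Require boolp classical_sets.
From Stdlib Require Import Classical ClassicalEpsilon FunctionalExtensionality.
From Stdlib Require Import PropExtensionality ProofIrrelevance.
From Stdlib Require List.
Set Implicit Arguments. Unset Strict Implicit. Unset Printing Implicit Defensive.
Import GRing.Theory.
Local Open Scope ring_scope.

Ltac field_nz := field; repeat (apply/andP; split); try done.

Section MulClosed.
Variables (R : comPzSemiRingType) (T : Type) (S : R -> Prop) (f : T -> R).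
Hypotheses (S1 : S 1) (SM : forall a b, S a -> S b -> S (a * b)).

Lemma foldr_mul_closed (L : seq T) : (forall Q, List.In Q L -> S (f Q)) ->
  S (foldr (fun Q acc => f Q * acc) 1 L).
Proof.
elim: L => [|Q L IH] Lf //=.
by apply: SM; [apply: Lf; left|apply: IH => Q' LQ'; apply: Lf; right].
Qed.

Lemma foldr_mul_NoDup (L : seq T) P : List.NoDup L -> List.In P L ->
  (forall Q, List.In Q L -> Q <> P -> S (f Q)) ->
  exists r, S r /\ foldr (fun Q acc => f Q * acc) 1 L = f P * r.
Proof.
elim: L => [|Q L IH] //= ndL LP Lf.
have [QL ndL'] : ~ List.In Q L /\ List.NoDup L by inversion ndL.
case: LP => [QP|LP].
  subst Q; exists (foldr (fun Q acc => f Q * acc) 1 L); split => //.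
  apply: foldr_mul_closed => Q' LQ'; apply: Lf; first by right.
  by move=> Q'P; apply: QL; rewrite -Q'P.
have [r [Sr ->]] := IH ndL' LP (fun Q' LQ' => Lf Q' (or_intror LQ')).
exists (f Q * r); split; last by rewrite mulrCA.
apply: SM => //; apply: Lf; first by left.
by move=> QP; apply: QL; rewrite QP.
Qed.

End MulClosed.

Lemma exists_NoDup_filter (T : Type) (L : seq T) (p : T -> Prop) :
  exists L', List.NoDup L' /\ forall P, List.In P L' <-> List.In P L /\ p P.
Proof.
elim: L => [|a L [L1 [ndL1 L1E]]]; first by exists [::]; split; [constructor|move=> P;
  split => [[]|[[] _]]].
case: (classic (p a /\ ~ List.In a L1)) => [[pa L1a]|na].
  exists (a :: L1); split; first by constructor.
  move=> P; split => [[<-|/L1E [LP pP]]|[[<-|LP] pP]].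
  - by split => //; left.
  - by split => //; right.
  - by left.
  - by right; apply/L1E.
exists L1; split => // P; split => [/L1E [LP pP]|[[<-|LP] pP]]; first by split => //; right.
  by apply: NNPP => L1P; apply: na.
by apply/L1E.
Qed.

Lemma In_map_iff (T1 T2 : Type) (f : T1 -> T2) (L : seq T1) y :
  List.In y (map f L) <-> exists x, List.In x L /\ y = f x.
Proof.
elim: L => [|a L IH]; first by split => [[]|[x [[] _]]].
split => /=.
  case=> [<-|yL]; first by exists a; split => //; left.
  by have [x [Lx ->]] := proj1 IH yL; exists x; split => //; right.
case=> x [[<-|Lx] yE]; first by left; rewrite yE.
by right; apply/IH; exists x.
Qed.

Lemma mem_map_In (T1 : Type) (T2 : eqType) (f : T1 -> T2) (L : seq T1) y :
  y \in map f L <-> exists x, List.In x L /\ y = f x.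
Proof.
elim: L => [|a L IH] /=; first by split => [|[x [[] _]]]; rewrite in_nil.
rewrite in_cons; split => [/orP [/eqP ->|/IH [x [Lx yE]]]|[x [[<-|Lx] yE]]].
- by exists a; split => //; left.
- by exists x; split => //; right.
- by rewrite yE eqxx.
- by apply/orP; right; apply/IH; exists x.
Qed.

Section Domain.
Variables (K : fieldType) (D : kset K).

Lemma kset_ext (A B : kset K) : subs A B -> subs B A -> A = B.
Proof.
move=> AB BA; apply: functional_extensionality => x.
by apply: propositional_extensionality; split; [exact: AB|exact: BA].
Qed.
Hypothesis subringD : is_subring D.
Hypothesis quotD : is_quotient_field D.

Lemma memD0 : D 0. Proof. by case: subringD. Qed.
Lemma memD1 : D 1. Proof. by case: subringD => _ []. Qed.
Lemma memDB a b : D a -> D b -> D (a - b).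
Proof. by case: subringD => _ [_ [h _]]; exact: h. Qed.
Lemma memDM a b : D a -> D b -> D (a * b).
Proof. by case: subringD => _ [_ [_ h]]; exact: h. Qed.
Lemma memDN a : D a -> D (- a).
Proof. by move=> Da; rewrite -sub0r; exact: memDB memD0 Da. Qed.
Lemma memDD a b : D a -> D b -> D (a + b).
Proof. by move=> Da Db; rewrite -[b]opprK; apply: memDB => //; exact: memDN. Qed.
Lemma memDX a n : D a -> D (a ^+ n).
Proof.
move=> Da; elim: n => [|n IH]; first by rewrite expr0; exact: memD1.
by rewrite exprS; exact: memDM.
Qed.

Lemma D_submod : submodule D D.
Proof. by split; [exact: memD0|split; [exact: memDD|move=> d a; exact: memDM]]. Qed.

Section Submodule.
Variable X : kset K.
Hypothesis subX : submodule D X.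

Lemma submod0 : X 0. Proof. by case: subX. Qed.
Lemma submodD a b : X a -> X b -> X (a + b).
Proof. by case: subX => _ [h _]; exact: h. Qed.
Lemma submodZ d a : D d -> X a -> X (d * a).
Proof. by case: subX => _ [_ h]; exact: h. Qed.

Lemma submod_eqD : subs X D -> X 1 -> X = D.
Proof. by move=> XD X1; apply: kset_ext => // x Dx; rewrite -[x]mulr1; exact: submodZ. Qed.

Lemma submod_proper_not1 : subs X D -> X <> D -> ~ X 1.
Proof. by move=> XD XneD X1; apply: XneD; exact: submod_eqD. Qed.

End Submodule.

Lemma submod_scale u T : submodule D T -> submodule D (fun y => T (u * y)).
Proof.
move=> subT; split; first by rewrite mulr0; exact: submod0.
split; first by move=> a b Ta Tb; rewrite mulrDr; exact: submodD.
by move=> d a Dd Ta; rewrite mulrCA; exact: submodZ.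
Qed.

Lemma gen_submod A : submodule D (gen D A).
Proof.
split; first by move=> S subS _; exact: submod0.
split; first by move=> a b ga gb S subS AS; apply: submodD; [|exact: ga|exact: gb].
by move=> d a Dd ga S subS AS; apply: submodZ => //; exact: ga.
Qed.

Lemma gen_sub A : subs A (gen D A).
Proof. by move=> x Ax S _ AS; exact: AS. Qed.

Lemma gen_min A S : submodule D S -> subs A S -> subs (gen D A) S.
Proof. by move=> subS AS x gx; exact: gx. Qed.

Definition gens (s : seq K) := gen D (fun x => x \in s).

Lemma gens_mem s e : e \in s -> gens s e.
Proof. exact: gen_sub. Qed.

Lemma gens_subset s1 s2 : {subset s1 <= s2} -> subs (gens s1) (gens s2).
Proof. by move=> s12; apply: gen_min; [exact: gen_submod|move=> e /s12; exact: gens_mem]. Qed.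

Lemma gens_min s S : submodule D S -> (forall e, e \in s -> S e) -> subs (gens s) S.
Proof. exact: gen_min. Qed.

Lemma gens_eq0 s y : (forall e, e \in s -> e = 0) -> gens s y -> y = 0.
Proof.
move=> s0; apply: (gens_min (S := fun z => z = 0)) => //.
by split => //; split; [move=> a b -> ->; rewrite addr0|move=> d a _ ->; rewrite mulr0].
Qed.

Lemma gens_bounded (s : seq K) :
  exists d, D d /\ d != 0 /\ forall x, gens s x -> D (d * x).
Proof.
elim: s => [|a s [d [Dd [d0 ds]]]].
  exists 1; split; first exact: memD1.
  split; first exact: oner_neq0.
  by move=> x gx; rewrite mul1r; apply: (gens_min D_submod) gx.
have [p [q [Dp [Dq [q0 ->]]]]] := quotD a.
exists (q * d); split; first exact: memDM.
split; first by rewrite mulf_neq0.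
move=> x; apply: (gens_min (submod_scale (q * d) D_submod)) => y.
rewrite in_cons => /orP [/eqP ->|sy].
  have -> : q * d * (p / q) = d * p by field_nz.
  exact: memDM.
by rewrite -mulrA; apply: memDM => //; apply: ds; exact: gens_mem.
Qed.

Lemma gens_fractional s : (exists y, gens s y /\ y != 0) -> fractional D (gens s).
Proof. by move=> nz; split; [exact: gen_submod|split => //; exact: gens_bounded]. Qed.

Lemma fin_gen_fractional J : fin_gen D J -> (exists y, J y /\ y != 0) -> fractional D J.
Proof. by move=> [s ->]; exact: gens_fractional. Qed.

Lemma fractional_submod X : fractional D X -> submodule D X.
Proof. by case. Qed.

Lemma D_fractional : fractional D D.
Proof.
split; first exact: D_submod.
split; first by exists 1; split; [exact: memD1|exact: oner_neq0].
by exists 1; split; [exact: memD1|split; [exact: oner_neq0|move=> x Dx; rewrite mul1r]].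
Qed.

Lemma prin1 : prin D 1 = D.
Proof.
apply: kset_ext => x; first by move=> [d [Dd ->]]; rewrite mulr1.
by move=> Dx; exists x; rewrite mulr1.
Qed.

Lemma prin_submod x : submodule D (prin D x).
Proof.
split; first by exists 0; split; [exact: memD0|rewrite mul0r].
split; first by move=> a b [d [Dd ->]] [e [De ->]]; exists (d + e); rewrite mulrDl;
  split => //; exact: memDD.
by move=> d a Dd [e [De ->]]; exists (d * e); rewrite mulrA; split => //; exact: memDM.
Qed.

Lemma prin_self x : prin D x x.
Proof. by exists 1; rewrite mul1r; split => //; exact: memD1. Qed.

Lemma prin_integral a : D a -> subs (prin D a) D.
Proof. by move=> Da y [d [Dd ->]]; exact: memDM. Qed.

Lemma prin_fractional x : x != 0 -> fractional D (prin D x).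
Proof.
move=> x0; split; first exact: prin_submod.
split; first by exists x; split => //; exact: prin_self.
have [p [q [Dp [Dq [q0 xE]]]]] := quotD x.
exists q; split => //; split => // y [e [De ->]].
rewrite xE; have -> : q * (e * (p / q)) = e * p by field_nz.
exact: memDM.
Qed.

Lemma mulset_fractional x I : x != 0 -> fractional D I -> fractional D (mulset x I).
Proof.
move=> x0 [subI [[y [Iy y0]] [d [Dd [d0 dI]]]]].
split.
  split; first by exists 0; split; [exact: submod0|rewrite mulr0].
  split; first by move=> a b [z [Iz ->]] [w [Iw ->]]; exists (z + w); rewrite mulrDr;
    split => //; exact: submodD.
  by move=> e a De [z [Iz ->]]; exists (e * z); rewrite mulrCA; split => //; exact: submodZ.
split; first by exists (x * y); split; [exists y|rewrite mulf_neq0].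
have [p [q [Dp [Dq [q0 xE]]]]] := quotD x.
exists (q * d); split; first exact: memDM.
split; first by rewrite mulf_neq0.
move=> z [w [Iw ->]]; rewrite xE.
have -> : q * d * (p / q * w) = p * (d * w) by field_nz.
by apply: memDM => //; exact: dI.
Qed.

Lemma iprod_mem I J a b : I a -> J b -> iprod D I J (a * b).
Proof. by move=> Ia Jb; apply: gen_sub; exists a, b. Qed.

Lemma iprod_fractional I J : fractional D I -> fractional D J -> fractional D (iprod D I J).
Proof.
move=> [_ [[a [Ia a0]] [d1 [Dd1 [d10 dI]]]]] [_ [[b [Jb b0]] [d2 [Dd2 [d20 dJ]]]]].
split; first exact: gen_submod.
split; first by exists (a * b); split; [exact: iprod_mem|rewrite mulf_neq0].
exists (d1 * d2); split; first exact: memDM.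
split; first by rewrite mulf_neq0.
move=> x; apply: (gen_min (submod_scale _ D_submod)) => z [a' [b' [Ia' [Jb' ->]]]].
have -> : d1 * d2 * (a' * b') = (d1 * a') * (d2 * b') by ring.
by apply: memDM; [exact: dI|exact: dJ].
Qed.

Lemma iprod_integral I J : subs I D -> subs J D -> subs (iprod D I J) D.
Proof.
move=> ID JD x; apply: (gen_min D_submod) => z [a [b [Ia [Jb ->]]]].
by apply: memDM; [exact: ID|exact: JD].
Qed.

Lemma isum_submod I J : submodule D I -> submodule D J -> submodule D (isum I J).
Proof.
move=> subI subJ; split; first by exists 0, 0; rewrite addr0; split; [|split] => //; exact: submod0.
split.
  move=> x y [a [b [Ia [Jb ->]]]] [c [e [Ic [Je ->]]]].
  exists (a + c), (b + e); split; first exact: submodD.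
  by split; [exact: submodD|ring].
move=> d x Dd [a [b [Ia [Jb ->]]]]; exists (d * a), (d * b).
by split; [exact: submodZ|split; [exact: submodZ|ring]].
Qed.

Lemma isuml I J a : submodule D J -> I a -> isum I J a.
Proof. by move=> subJ Ia; exists a, 0; rewrite addr0; split => //; split => //; exact: submod0. Qed.

Lemma isumr I J b : submodule D I -> J b -> isum I J b.
Proof. by move=> subI Jb; exists 0, b; rewrite add0r; split => //; exact: submod0. Qed.

Lemma isum_fractional I J : fractional D I -> fractional D J -> fractional D (isum I J).
Proof.
move=> [subI [[a [Ia a0]] [d1 [Dd1 [d10 dI]]]]] [subJ [_ [d2 [Dd2 [d20 dJ]]]]].
split; first exact: isum_submod.
split; first by exists a; split => //; exact: isuml.
exists (d1 * d2); split; first exact: memDM.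
split; first by rewrite mulf_neq0.
move=> x [a' [b' [Ia' [Jb' ->]]]].
have -> : d1 * d2 * (a' + b') = d2 * (d1 * a') + d1 * (d2 * b') by ring.
by apply: memDD; apply: memDM => //; [exact: dI|exact: dJ].
Qed.

Lemma isum_integral I J : subs I D -> subs J D -> subs (isum I J) D.
Proof. by move=> ID JD x [a [b [Ia [Jb ->]]]]; apply: memDD; [exact: ID|exact: JD]. Qed.

Lemma iinv_fractional I : fractional D I -> fractional D (Defs.iinv D I).
Proof.
move=> [_ [[a [Ia a0]] [d [Dd [d0 dI]]]]].
split.
  split; first by move=> y _; rewrite mul0r; exact: memD0.
  split; first by move=> x y Ix Iy z Iz; rewrite mulrDl; apply: memDD; [exact: Ix|exact: Iy].
  by move=> e x De Ix z Iz; rewrite -mulrA; apply: memDM => //; exact: Ix.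
split; first by exists d.
have [p [q [Dp [Dq [q0 aE]]]]] := quotD a.
have p0 : p != 0 by apply: contraNneq a0 => p0; rewrite aE p0 mul0r.
exists p; split => //; split => // x Ix.
have -> : p * x = q * (x * a) by rewrite aE; field.
by apply: memDM => //; exact: Ix.
Qed.

Lemma iprod_iinv_integral I : subs (iprod D I (Defs.iinv D I)) D.
Proof.
move=> z; apply: (gen_min D_submod) => w [a [b [Ia [Ib ->]]]].
by rewrite mulrC; exact: Ib.
Qed.

Lemma decomp_isum P Q (s : seq K) : (forall e, e \in s -> isum P Q e) ->
  exists sp sq : seq K, (forall e, e \in sp -> P e) /\ (forall e, e \in sq -> Q e) /\
    (forall e, e \in s -> exists a b, a \in sp /\ b \in sq /\ e = a + b).
Proof.
elim: s => [|e s IH] sPQ; first by exists [::], [::].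
have [sp [sq [spP [sqQ sE]]]] : exists sp sq : seq K, (forall e, e \in sp -> P e) /\
    (forall e, e \in sq -> Q e) /\
    (forall e, e \in s -> exists a b, a \in sp /\ b \in sq /\ e = a + b).
  by apply: IH => e' se'; apply: sPQ; rewrite in_cons se' orbT.
have [a [b [Pa [Qb eE]]]] : isum P Q e by apply: sPQ; exact: mem_head.
exists (a :: sp), (b :: sq); split; first by move=> y; rewrite in_cons => /orP [/eqP ->|/spP].
split; first by move=> y; rewrite in_cons => /orP [/eqP ->|/sqQ].
move=> y; rewrite in_cons => /orP [/eqP ->|/sE [a' [b' [spa' [sqb' ->]]]]].
  by exists a, b; rewrite !mem_head.
by exists a', b'; rewrite !in_cons spa' sqb' !orbT.
Qed.

Definition iprods (ls : seq (kset K)) := foldr (iprod D) D ls.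

Lemma iprods_fractional (ls : seq (kset K)) :
  (forall I, List.In I ls -> fractional D I) -> fractional D (iprods ls).
Proof.
elim: ls => [|I ls IH] lsF /=; first exact: D_fractional.
by apply: iprod_fractional; [apply: lsF; left|apply: IH => J lsJ; apply: lsF; right].
Qed.

Lemma iprods_integral (ls : seq (kset K)) :
  (forall I, List.In I ls -> subs I D) -> subs (iprods ls) D.
Proof.
elim: ls => [|I ls IH] lsD //=.
by apply: iprod_integral; [apply: lsD; left|apply: IH => J lsJ; apply: lsD; right].
Qed.

Lemma iprods_mem (T : Type) (I : T -> kset K) (f : T -> K) (L : seq T) :
  (forall Q, List.In Q L -> I Q (f Q)) ->
  iprods (map I L) (foldr (fun Q acc => f Q * acc) 1 L).
Proof.
elim: L => [|Q L IH] If /=; first exact: memD1.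
by apply: iprod_mem; [apply: If; left|apply: IH => Q' LQ'; apply: If; right].
Qed.

Definition prime_ideal (P : kset K) := submodule D P /\ subs P D /\ ~ P 1 /\
  (forall a b, D a -> D b -> P (a * b) -> P a \/ P b).

Section Prime.
Variable P : kset K.
Hypothesis primeP : prime_ideal P.

Lemma prime_submod : submodule D P. Proof. by case: primeP. Qed.
Lemma prime_integral : subs P D. Proof. by case: primeP => _ []. Qed.
Lemma prime_not1 : ~ P 1. Proof. by case: primeP => _ [_ []]. Qed.
Lemma primeM a b : D a -> D b -> P (a * b) -> P a \/ P b.
Proof. by case: primeP => _ [_ [_ h]]; exact: h. Qed.

Lemma prime_neq0 s : ~ P s -> s != 0.
Proof. by move=> Ps; apply/eqP => s0; apply: Ps; rewrite s0; exact: submod0 prime_submod. Qed.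

Lemma prime_notM s t : D s -> D t -> ~ P s -> ~ P t -> ~ P (s * t).
Proof. by move=> Ds Dt Ps Pt /(primeM Ds Dt) []. Qed.

Lemma prime_notX y n : D y -> ~ P y -> ~ P (y ^+ n).
Proof.
move=> Dy Py; elim: n => [|n IH]; first by rewrite expr0; exact: prime_not1.
by rewrite exprS; apply: prime_notM => //; exact: memDX.
Qed.

Lemma primeX y n : D y -> P (y ^+ n.+1) -> P y.
Proof. by move=> Dy Pyn; apply: NNPP => Py; exact: prime_notX Dy Py Pyn. Qed.

Lemma prime_not_unit x : x != 0 -> D x^-1 -> ~ P x.
Proof. by move=> x0 Dxi Px; apply: prime_not1; rewrite -(mulVf x0);
  exact: (submodZ prime_submod Dxi Px). Qed.

Lemma prime_iprods (ls : seq (kset K)) : (forall I, List.In I ls -> subs I D) ->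
  subs (iprods ls) P -> exists I, List.In I ls /\ subs I P.
Proof.
elim: ls => [|I ls IH] lsD /= FP; first by case: prime_not1; exact: FP memD1.
case: (classic (subs I P)) => [IP|nIP]; first by exists I; split => //; left.
have [a [Ia Pa]] : exists a, I a /\ ~ P a.
  by apply: NNPP => na; apply: nIP => a Ia; apply: NNPP => Pa; apply: na; exists a.
have [J [lsJ JP]] : exists J, List.In J ls /\ subs J P.
  apply: IH => [J lsJ|b Fb]; first by apply: lsD; right.
  have Da : D a by exact: lsD I (or_introl erefl) a Ia.
  have Db : D b by apply: (iprods_integral (ls := ls)) Fb => J lsJ; apply: lsD; right.
  by case: (primeM Da Db (FP _ (iprod_mem Ia Fb))).
by exists J; split => //; right.
Qed.

Notation loc := (localization D P).

Lemma loc_div a s : D a -> D s -> ~ P s -> loc (a / s).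
Proof. by move=> Da Ds Ps; exists a, s. Qed.

Lemma loc_D z : D z -> loc z.
Proof. by move=> Dz; rewrite -[z]divr1; apply: loc_div => //; [exact: memD1|exact: prime_not1]. Qed.

Lemma loc_inv s : D s -> ~ P s -> loc s^-1.
Proof. by move=> Ds Ps; rewrite -div1r; apply: loc_div => //; exact: memD1. Qed.

Lemma loc_mul x y : loc x -> loc y -> loc (x * y).
Proof.
move=> [a [s [Da [Ds [Ps ->]]]]] [b [t [Db [Dt [Pt ->]]]]].
have s0 := prime_neq0 Ps; have t0 := prime_neq0 Pt.
have -> : a / s * (b / t) = (a * b) / (s * t) by field_nz.
by apply: loc_div; [exact: memDM|exact: memDM|exact: prime_notM].
Qed.

Lemma loc_add x y : loc x -> loc y -> loc (x + y).
Proof.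
move=> [a [s [Da [Ds [Ps ->]]]]] [b [t [Db [Dt [Pt ->]]]]].
have s0 := prime_neq0 Ps; have t0 := prime_neq0 Pt.
have -> : a / s + b / t = (a * t + b * s) / (s * t) by field_nz.
by apply: loc_div; [apply: memDD; exact: memDM|exact: memDM|exact: prime_notM].
Qed.

Lemma loc_exp x n : loc x -> loc (x ^+ n).
Proof.
move=> lx; elim: n => [|n IH]; first by rewrite expr0; apply: loc_D; exact: memD1.
by rewrite exprS; exact: loc_mul.
Qed.

Lemma loc_common_denominator (s : seq K) (f : K -> K) : (forall e, e \in s -> loc (f e)) ->
  exists t, D t /\ ~ P t /\ forall e, e \in s -> D (t * f e).
Proof.
elim: s => [|a s IH] sf; first by exists 1; split; [exact: memD1|split; [exact: prime_not1|]].
have [t [Dt [Pt st]]] : exists t, D t /\ ~ P t /\ forall e, e \in s -> D (t * f e).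
  by apply: IH => e se; apply: sf; rewrite in_cons se orbT.
have [b [u [Db [Du [Pu faE]]]]] : loc (f a) by apply: sf; exact: mem_head.
exists (u * t); split; first exact: memDM.
split; first exact: prime_notM.
move=> e; rewrite in_cons => /orP [/eqP ->|se].
  rewrite faE; have u0 := prime_neq0 Pu.
  have -> : u * t * (b / u) = t * b by field_nz.
  exact: memDM.
by rewrite -mulrA; apply: memDM => //; exact: st.
Qed.

Lemma loc_divides_mem x e : x != 0 -> P x -> D e -> loc (e / x) -> P e.
Proof.
move=> x0 Px De [a [s [Da [Ds [Ps eE]]]]].
have s0 := prime_neq0 Ps.
have seE : s * e = a * x.
  have -> : e = (e / x) * x by field_nz.
  by rewrite eE; field_nz.
have : P (s * e) by rewrite seE; exact: (submodZ prime_submod Da Px).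
by case/(primeM Ds De).
Qed.

Lemma valuation_loc_min_gen (s : seq K) : valuation_domain loc ->
  (exists y, y \in s /\ y != 0) ->
  exists k, k \in s /\ k != 0 /\ forall j, j \in s -> loc (j / k).
Proof.
move=> val; elim: s => [|a s IH] [y [sy y0]]; first by rewrite in_nil in sy.
have loc0 : loc 0 by apply: loc_D; exact: memD0.
case: (classic (exists y, y \in s /\ y != 0)) => [nzs|zs].
  have [k [sk [k0 ks]]] := IH nzs.
  have [->|a0] := eqVneq a 0.
    exists k; split; first by rewrite in_cons sk orbT.
    by split => // j; rewrite in_cons => /orP [/eqP ->|/ks]; rewrite ?mul0r.
  have ak0 : a / k != 0 by rewrite mulf_neq0 // invr_neq0.
  case: (val _ ak0) => [lak|lka].
    exists k; split; first by rewrite in_cons sk orbT.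
    by split => // j; rewrite in_cons => /orP [/eqP ->|/ks].
  exists a; split; first exact: mem_head.
  split => // j; rewrite in_cons => /orP [/eqP ->|sj].
    by rewrite divff //; apply: loc_D; exact: memD1.
  have -> : j / a = (j / k) * (a / k)^-1 by field_nz.
  by apply: loc_mul => //; exact: ks.
have a0 : a != 0.
  by move: sy; rewrite in_cons => /orP [/eqP <-|sy] //; case: zs; exists y.
exists a; split; first exact: mem_head.
split => // j; rewrite in_cons => /orP [/eqP ->|sj].
  by rewrite divff //; apply: loc_D; exact: memD1.
suff -> : j = 0 by rewrite mul0r.
by apply: NNPP => j0; apply: zs; exists j; split => //; apply/eqP.
Qed.

End Prime.

Section LocalRadical.
Variables (Q : kset K) (x : K).
Hypotheses (primeQ : prime_ideal Q) (valQ : valuation_domain (localization D Q)).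
Hypotheses (Dx : D x) (x0 : x != 0) (Qx : Q x).

Notation locQ := (localization D Q).

(* The radical of x D_Q, contracted to D. *)
Definition loc_radical : kset K := fun y => D y /\ exists n, locQ (y ^+ n.+1 / x).

Lemma loc_radical_sub : subs loc_radical Q.
Proof.
move=> y [Dy [n lyn]].
exact: (primeX primeQ Dy (loc_divides_mem primeQ x0 Qx (memDX n.+1 Dy) lyn)).
Qed.

Lemma loc_radical_sub_prime P : prime_ideal P ->
  (forall y, D y -> locQ (y / x) -> P y) -> subs loc_radical P.
Proof. by move=> primeP Pdiv y [Dy [n lyn]];
  exact: (primeX primeP Dy (Pdiv _ (memDX n.+1 Dy) lyn)). Qed.

Lemma loc_radical_submod : submodule D loc_radical.
Proof.
split; first by split; [exact: memD0|exists 0%N; rewrite expr1 mul0r; apply: (loc_D primeQ);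
  exact: memD0].
split; last first.
  move=> d a Dd [Da [n lan]]; split; first exact: memDM.
  exists n; rewrite exprMn -mulrA; apply: (loc_mul primeQ _ lan).
  by apply: (loc_D primeQ); exact: memDX.
move=> a b [Da [n lan]] [Db [m lbm]]; split; first exact: memDD.
have [->|a0] := eqVneq a 0; first by rewrite add0r; exists m.
have [->|b0] := eqVneq b 0; first by rewrite addr0; exists n.
have l1 : locQ 1 by apply: (loc_D primeQ); exact: memD1.
have ab0 : a / b != 0 by rewrite mulf_neq0 // invr_neq0.
case: (valQ ab0) => lab.
  exists m; have -> : (a + b) ^+ m.+1 / x = (1 + a / b) ^+ m.+1 * (b ^+ m.+1 / x).
    by rewrite mulrA -exprMn; congr (_ ^+ _ / _); field_nz.
  by apply: (loc_mul primeQ _ lbm); apply: (loc_exp primeQ); exact: (loc_add primeQ l1 lab).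
exists n; have -> : (a + b) ^+ n.+1 / x = (1 + (a / b)^-1) ^+ n.+1 * (a ^+ n.+1 / x).
  by rewrite mulrA -exprMn; congr (_ ^+ _ / _); field_nz.
by apply: (loc_mul primeQ _ lan); apply: (loc_exp primeQ); exact: (loc_add primeQ l1 lab).
Qed.

Lemma loc_radicalM_l a b : D a -> b != 0 -> locQ (a / b) ->
  loc_radical (a * b) -> loc_radical a.
Proof.
move=> Da b0 lab [_ [n labn]]; split => //; exists (n.+1 + n)%N.
have -> : a ^+ (n.+1 + n).+1 / x = ((a * b) ^+ n.+1 / x) * (a / b) ^+ n.+1.
  have -> : a ^+ (n.+1 + n).+1 = (a * b) ^+ n.+1 * (a / b) ^+ n.+1.
    by rewrite -addnS exprD -!exprMn; congr (_ ^+ _); field_nz.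
  by rewrite mulrAC.
by apply: (loc_mul primeQ labn); exact: loc_exp.
Qed.

Lemma loc_radical_prime : nonzero_prime_ideal D loc_radical.
Proof.
split; first exact: loc_radical_submod.
split.
  split; first by move=> y [].
  by move=> e; apply: (prime_not1 primeQ); apply: loc_radical_sub; rewrite e; exact: memD1.
split.
  exists x; split => //; split => //; exists 0%N.
  by rewrite expr1 divff //; apply: (loc_D primeQ); exact: memD1.
move=> a b Da Db rab.
have [->|a0] := eqVneq a 0; first by left; exact: (submod0 loc_radical_submod).
have [->|b0] := eqVneq b 0; first by right; exact: (submod0 loc_radical_submod).
have ab0 : a / b != 0 by rewrite mulf_neq0 // invr_neq0.
case: (valQ ab0) => lab; first by left; exact: (loc_radicalM_l Da b0 lab rab).
right; apply: (loc_radicalM_l Db a0); first by rewrite -invf_div.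
by rewrite mulrC.
Qed.

End LocalRadical.

(* [loc_divides P c A] says that [A] is contained in [c D_P] when [c != 0]. *)
Definition loc_divides (P : kset K) (c : K) (A : kset K) :=
  forall z, A z -> localization D P (z / c).

Section LocDivides.
Variable P : kset K.
Hypothesis primeP : prime_ideal P.

Lemma loc_divides_submod c : submodule D (fun y => localization D P (y / c)).
Proof.
split; first by rewrite mul0r; apply: (loc_D primeP); exact: memD0.
split; first by move=> a b la lb; rewrite mulrDl; exact: loc_add.
by move=> d a Dd la; rewrite -mulrA; apply: (loc_mul primeP) la; exact: loc_D.
Qed.

Lemma loc_divides_gen c A : loc_divides P c A -> loc_divides P c (gen D A).
Proof. exact: gen_min (loc_divides_submod c). Qed.

Lemma loc_divides_integral A : subs A D -> loc_divides P 1 A.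
Proof. by move=> AD z Az; rewrite divr1; apply: (loc_D primeP); exact: AD. Qed.

Lemma loc_dividesM c c' A B : c != 0 -> c' != 0 ->
  loc_divides P c A -> loc_divides P c' B -> loc_divides P (c * c') (iprod D A B).
Proof.
move=> c0 c'0 cA c'B; apply: loc_divides_gen => _ [a [b [Aa [Bb ->]]]].
have -> : a * b / (c * c') = (a / c) * (b / c') by field_nz.
by apply: (loc_mul primeP); [exact: cA|exact: c'B].
Qed.

Lemma loc_divides_iprods (T : Type) (I : T -> kset K) (c : T -> K) (L : seq T) :
  (forall Q, List.In Q L -> c Q != 0 /\ loc_divides P (c Q) (I Q)) ->
  loc_divides P (foldr (fun Q acc => c Q * acc) 1 L) (iprods (map I L)).
Proof.
elim: L => [|Q L IH] Lc /=; first by apply: loc_divides_integral => //.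
have [cQ0 cQ] := Lc Q (or_introl erefl).
have Lc' Q' : List.In Q' L -> c Q' != 0 /\ loc_divides P (c Q') (I Q') by move=> LQ';
  exact: Lc Q' (or_intror LQ').
apply: loc_dividesM => //; last exact: IH.
apply: (foldr_mul_closed (S := fun r => r != 0)) => [|a b a0 b0|Q' LQ']; first exact: oner_neq0.
  by rewrite mulf_neq0.
by case: (Lc' Q' LQ').
Qed.

End LocDivides.

Section Star.
Variable star : kset K -> kset K.
Hypotheses (starD : star_operation D star) (fcD : finite_character D star).

Notation maxI := (maximal_star_ideal D star).

Lemma star_fractional I : fractional D I -> fractional D (star I).
Proof. by case: starD => h _; exact: h. Qed.
Lemma star_prin x : x != 0 -> star (prin D x) = prin D x.
Proof. by case: starD => _ [h _]; exact: h. Qed.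
Lemma star_mulset x I : x != 0 -> fractional D I -> star (mulset x I) = mulset x (star I).
Proof. by case: starD => _ [_ [h _]]; exact: h. Qed.
Lemma star_sub I : fractional D I -> subs I (star I).
Proof. by case: starD => _ [_ [_ [h _]]]; exact: h. Qed.
Lemma star_mono I J : fractional D I -> fractional D J -> subs I J -> subs (star I) (star J).
Proof. by case: starD => _ [_ [_ [_ [h _]]]]; exact: h. Qed.
Lemma star_idem I : fractional D I -> star (star I) = star I.
Proof. by case: starD => _ [_ [_ [_ [_ h]]]]; exact: h. Qed.

Lemma star_D : star D = D.
Proof. by rewrite -prin1 star_prin // oner_neq0. Qed.

Lemma star_integral X : fractional D X -> subs X D -> subs (star X) D.
Proof. by move=> fX XD; rewrite -star_D; exact: (star_mono fX D_fractional XD). Qed.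

Lemma star_star_ideal X : fractional D X -> star_ideal D star (star X).
Proof. by move=> fX; split; [exact: star_fractional|exact: star_idem]. Qed.

Lemma D_star_ideal : star_ideal D star D.
Proof. by split; [exact: D_fractional|exact: star_D]. Qed.

Lemma star_ideal_sub X T : fractional D X -> star_ideal D star T -> subs X T -> subs (star X) T.
Proof. by move=> fX [fT TE] XT; rewrite -TE; exact: star_mono. Qed.

Lemma star_mul_sub u X T : fractional D X -> star_ideal D star T ->
  (forall y, X y -> T (u * y)) -> forall y, star X y -> T (u * y).
Proof.
move=> fX [fT TE] XuT y Xy.
have [->|u0] := eqVneq u 0; first by rewrite mul0r; exact: (submod0 (fractional_submod fT)).
have uXT : subs (mulset u X) T by move=> z [w [Xw ->]]; exact: XuT.
have := star_mono (mulset_fractional u0 fX) fT uXT.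
by rewrite TE star_mulset // => /(_ (u * y)); apply; exists y.
Qed.

Lemma star_mul_integral u X : fractional D X ->
  (forall y, X y -> D (u * y)) -> forall y, star X y -> D (u * y).
Proof. move=> fX; exact: star_mul_sub D_star_ideal. Qed.

(* Finite character reduces to finitely many generators, which have a common denominator
   outside [P]. *)
Lemma star_loc_divides P c X : prime_ideal P -> c != 0 -> fractional D X ->
  loc_divides P c X -> loc_divides P c (star X).
Proof.
move=> primeP c0 fX cX y; rewrite (fcD fX) => -[J [[s JE] [J0 [JX Jy]]]].
have fJ : fractional D J by apply: fin_gen_fractional => //; exists s.
have sJ e : e \in s -> J e by rewrite JE; exact: gens_mem.
have [t [Dt [Pt ts]]] := loc_common_denominator primeP (f := fun e => e / c)
   (fun e se => cX e (JX e (sJ e se))).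
have tcJ z : J z -> D ((t / c) * z).
  rewrite JE; apply: (gens_min (submod_scale _ D_submod)) => e se.
  by rewrite mulrAC -mulrA; exact: ts.
have t0 := prime_neq0 primeP Pt.
have -> : y / c = (t / c * y) / t by field_nz.
by apply: loc_div => //; exact: (star_mul_integral fJ tcJ Jy).
Qed.

Lemma maximal_is_star_ideal P : maxI P -> star_ideal D star P. Proof. by case. Qed.
Lemma maximal_fractional P : maxI P -> fractional D P. Proof. by case=> [[]]. Qed.
Lemma maximal_integral P : maxI P -> subs P D. Proof. by case=> _ [[]]. Qed.

Lemma maximal_not1 P : maxI P -> ~ P 1.
Proof.
move=> [[fP _] [[PD PneD] _]]; apply: submod_proper_not1 => //; exact: fractional_submod.
Qed.

Lemma maximal_eq P Q : maxI P -> star_ideal D star Q -> subs Q D -> ~ Q 1 -> subs P Q -> Q = P.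
Proof.
move=> [_ [_ maxP]] idQ QD Q1 PQ; apply: maxP => //; split => // QE.
by apply: Q1; rewrite QE; exact: memD1.
Qed.

Lemma maximal_star_isum1 P Y : maxI P -> fractional D Y -> subs Y D -> ~ subs Y P ->
  star (isum P Y) 1.
Proof.
move=> maxP fY YD YP; apply: NNPP => S1.
have subP := fractional_submod (maximal_fractional maxP).
have fS : fractional D (isum P Y) by apply: isum_fractional => //; exact: maximal_fractional.
have SE : star (isum P Y) = P.
  apply: maximal_eq => //; first exact: star_star_ideal.
    by apply: star_integral => //; apply: isum_integral => //; exact: maximal_integral.
  by move=> z Pz; apply: star_sub => //; apply: isuml => //; exact: fractional_submod.
by apply: YP => z Yz; rewrite -SE; apply: star_sub => //; exact: isumr.
Qed.

(* If [a] is not in [P], then [b (P + a D) <= P] and [(P + a D)^* = D]. *)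
Lemma maximal_prime P : maxI P -> prime_ideal P.
Proof.
move=> maxP; have fP := maximal_fractional maxP; have subP := fractional_submod fP.
split => //; split; first exact: maximal_integral.
split; first exact: maximal_not1.
move=> a b Da Db Pab; case: (classic (P a)) => Pa; [by left|right].
have [->|b0] := eqVneq b 0; first exact: submod0.
have a0 : a != 0 by apply/eqP => a0; apply: Pa; rewrite a0; exact: submod0.
have fX : fractional D (isum P (prin D a)) by apply: isum_fractional => //; exact: prin_fractional.
have X1 := maximal_star_isum1 maxP (prin_fractional a0) (prin_integral Da)
  (fun aP => Pa (aP a (prin_self a))).
have := star_mul_sub (u := b) fX (maximal_is_star_ideal maxP) _ X1; rewrite mulr1; apply.
move=> y [p [q [Pp [[d [Dd ->]] ->]]]].
rewrite mulrDr; apply: submodD => //; first exact: submodZ.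
have -> : b * (d * a) = d * (a * b) by ring.
exact: submodZ.
Qed.

Section ExistsMaximal.
Variable X : kset K.
Hypotheses (fX : fractional D X) (XD : subs X D) (X1 : ~ star X 1).

Definition proper_star_over (Y : kset K) :=
  star_ideal D star Y /\ subs Y D /\ ~ Y 1 /\ subs X Y.

Definition proper_star_overs := {Y : kset K | proper_star_over Y}.

Definition star_over_le (A B : proper_star_overs) : bool :=
  boolp.asbool (subs (sval A) (sval B)).

Lemma star_over_leP A B : star_over_le A B <-> subs (sval A) (sval B).
Proof. by split => /boolp.asboolP. Qed.

Lemma proper_star_over_star : proper_star_over (star X).
Proof.
split; first exact: star_star_ideal.
by split; [exact: star_integral|split; [|exact: star_sub]].
Qed.

Lemma sval_proper_star_over (Y : proper_star_overs) : proper_star_over (sval Y).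
Proof. by case: Y. Qed.

Lemma proper_star_overs_submod (Y : proper_star_overs) : submodule D (sval Y).
Proof. by case: (sval_proper_star_over Y) => [[fY _] _]; exact: fractional_submod. Qed.

Section ChainUnion.
Variables (A : classical_sets.set proper_star_overs) (Y0 : proper_star_overs).
Hypotheses (AY0 : A Y0) (totA : classical_sets.total_on A star_over_le).

Definition chain_union : kset K := fun z => exists Y, A Y /\ sval Y z.

Lemma chain_cmp Y1 Y2 : A Y1 -> A Y2 -> subs (sval Y1) (sval Y2) \/ subs (sval Y2) (sval Y1).
Proof. by move=> AY1 AY2; case: (totA AY1 AY2) => /star_over_leP; tauto. Qed.

Lemma chain_union_submod : submodule D chain_union.
Proof.
split; first by exists Y0; split => //; exact: (submod0 (proper_star_overs_submod Y0)).
split; last first.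
  move=> d z Dd [Y [AY Yz]]; exists Y; split => //.
  exact: (submodZ (proper_star_overs_submod Y) Dd Yz).
move=> z1 z2 [Y1 [AY1 Yz1]] [Y2 [AY2 Yz2]].
case: (chain_cmp AY1 AY2) => Y12.
  by exists Y2; split => //; apply: (submodD (proper_star_overs_submod Y2) _ Yz2); exact: Y12.
by exists Y1; split => //; apply: (submodD (proper_star_overs_submod Y1) Yz1); exact: Y12.
Qed.

Lemma chain_union_fractional : fractional D chain_union.
Proof.
split; first exact: chain_union_submod.
have [_ [_ [_ XY0]]] := sval_proper_star_over Y0.
split; first by case: fX => _ [[y [Xy y0]] _]; exists y; split => //; exists Y0; split => //;
  exact: XY0.
exists 1; split; first exact: memD1.
split; first exact: oner_neq0.
by move=> z [Y [_ Yz]]; rewrite mul1r; case: (sval_proper_star_over Y) => _ [YD _]; exact: YD.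
Qed.

Lemma chain_union_finite (s : seq K) : (forall e, e \in s -> chain_union e) ->
  exists Y, A Y /\ forall e, e \in s -> sval Y e.
Proof.
elim: s => [|e s IH] sU; first by exists Y0.
have [Y1 [AY1 Y1e]] : chain_union e by apply: sU; exact: mem_head.
have [Y2 [AY2 Y2s]] : exists Y, A Y /\ forall e, e \in s -> sval Y e.
  by apply: IH => e' se'; apply: sU; rewrite in_cons se' orbT.
case: (chain_cmp AY1 AY2) => Y12.
  by exists Y2; split => // e'; rewrite in_cons => /orP [/eqP ->|/Y2s]; [exact: Y12|].
by exists Y1; split => // e'; rewrite in_cons => /orP [/eqP ->|/Y2s /Y12].
Qed.

(* By finite character, [chain_union^*] is the union of the [J^*] for finitely generated
   [J] inside it, and each such [J] lies in a single member of the chain. *)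
Lemma chain_union_proper_star_over : proper_star_over chain_union.
Proof.
have fU := chain_union_fractional.
split.
  split => //; apply: kset_ext; last exact: star_sub.
  move=> y; rewrite (fcD fU) => -[J [[s JE] [J0 [JU Jy]]]].
  have [Y [AY Ys]] : exists Y, A Y /\ forall e, e \in s -> sval Y e.
    by apply: chain_union_finite => e se; apply: JU; rewrite JE; exact: gens_mem.
  have fJ : fractional D J by apply: fin_gen_fractional => //; exists s.
  have JY : subs J (sval Y) by rewrite JE; apply: gens_min => //; exact: proper_star_overs_submod.
  by exists Y; split => //; apply: star_ideal_sub JY y Jy => //; case: (sval_proper_star_over Y).
split; first by move=> z [Y [_ Yz]]; case: (sval_proper_star_over Y) => _ [YD _]; exact: YD.
split; first by move=> [Y [_ Y1]]; case: (sval_proper_star_over Y) => _ [_ [nY1 _]].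
have [_ [_ [_ XY0]]] := sval_proper_star_over Y0.
by move=> z Xz; exists Y0; split => //; exact: XY0.
Qed.

End ChainUnion.

Lemma proper_star_over_chain (A : classical_sets.set proper_star_overs) :
  classical_sets.total_on A star_over_le -> exists U, forall Y, A Y -> star_over_le Y U.
Proof.
move=> totA; case: (classic (exists Y0, A Y0)) => [[Y0 AY0]|noA]; last first.
  by exists (exist _ _ proper_star_over_star) => Y AY; case: noA; exists Y.
exists (exist _ _ (chain_union_proper_star_over AY0 totA)) => Y AY.
by apply/star_over_leP => z Yz; exists Y.
Qed.

Lemma exists_maximal : exists P, maxI P /\ subs X P.
Proof.
have le_refl Y : star_over_le Y Y by apply/star_over_leP.
have le_trans Y1 Y2 Y3 : star_over_le Y1 Y2 -> star_over_le Y2 Y3 -> star_over_le Y1 Y3.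
  by move=> /star_over_leP Y12 /star_over_leP Y23; apply/star_over_leP => z /Y12 /Y23.
have le_anti Y1 Y2 : star_over_le Y1 Y2 -> star_over_le Y2 Y1 -> Y1 = Y2.
  move: Y1 Y2 => [A oA] [B oB] /star_over_leP AB /star_over_leP BA.
  have AB' : A = B by apply: kset_ext.
  by subst B; rewrite (proof_irrelevance _ oA oB).
have [[P oP] maxP] := classical_sets.Zorn le_refl le_trans le_anti proper_star_over_chain.
move: (oP) => [idP [PD [P1 XP]]].
exists P; split => //; split => //; split.
  by split => // PE; apply: P1; rewrite PE; exact: memD1.
move=> Q idQ [QD QneD] PQ.
have Q1 : ~ Q 1 by apply: submod_proper_not1 => //; case: idQ => fQ _; exact: fractional_submod.
have oQ : proper_star_over Q by split => //; split => //; split => // z /XP /PQ.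
have := maxP (exist _ Q oQ);
  rewrite (proj2 (star_over_leP (exist _ P oP) (exist _ Q oQ)) PQ) => /(_ isT).
by move/(f_equal sval).
Qed.

End ExistsMaximal.

(* The conductor [{d | z d \in D}] lies in no maximal star ideal. *)
Lemma mem_of_loc_maximal z : (forall P, maxI P -> localization D P z) -> D z.
Proof.
move=> locz; apply: NNPP => Dz.
pose C d := D d /\ D (z * d).
have [a [b [Da [Db [b0 zE]]]]] := quotD z.
have Cb : C b by split => //; rewrite zE; have -> : a / b * b = a by field_nz.
have subC : submodule D C.
  split; first by split; [exact: memD0|rewrite mulr0; exact: memD0].
  split; first by move=> x y [Dx Dzx] [Dy Dzy]; split; [exact: memDD|rewrite mulrDr; exact: memDD].
  by move=> d x Dd [Dx Dzx]; split; [exact: memDM|rewrite mulrCA; exact: memDM].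
have fC : fractional D C.
  split => //; split; first by exists b.
  exists 1; split; first exact: memD1.
  by split; [exact: oner_neq0|move=> x [Dx _]; rewrite mul1r].
have C1 : ~ star C 1.
  by move=> C1; apply: Dz; rewrite -[z]mulr1; apply: (star_mul_integral fC) C1 => y [].
have [P [maxP CP]] := exists_maximal fC (fun x Cx => proj1 Cx) C1.
have [a' [s [Da' [Ds [Ps zE']]]]] := locz P maxP.
have s0 := prime_neq0 (maximal_prime maxP) Ps.
apply: Ps; apply: CP; split => //.
by rewrite zE'; have -> : a' / s * s = a' by field_nz.
Qed.

(* Over a valuation localization, a finite generating set has an element dividing the others
   locally, which exhibits an element of [J J^-1] outside [P]. *)
Lemma finite_type_star_invertible J :
  (forall P, maxI P -> valuation_domain (localization D P)) ->
  star_ideal D star J -> finite_type D star J -> star_invertible D star J.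
Proof.
move=> val [fJ _] [G [[s GE] [G0 JE]]].
have fG : fractional D G by apply: fin_gen_fractional => //; exists s.
split => //.
pose X := iprod D J (Defs.iinv D J).
have fX : fractional D X by apply: iprod_fractional => //; exact: iinv_fractional.
have XD : subs X D by exact: iprod_iinv_integral.
apply: submod_eqD; [exact: fractional_submod (star_fractional fX)|exact: star_integral|].
apply: NNPP => X1.
have [P [maxP XP]] := exists_maximal fX XD X1.
have primeP := maximal_prime maxP.
have s0 : exists y, y \in s /\ y != 0.
  apply: NNPP => s0; move: G0 => [y [Gy /negP]]; apply; apply/eqP.
  apply: (gens_eq0 (s := s)); last by rewrite /gens -GE.
  by move=> e se; apply: NNPP => e0; apply: s0; exists e; split => //; apply/eqP.
have [k [sk [k0 ks]]] := valuation_loc_min_gen primeP (val P maxP) s0.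
have [t [Dt [Pt ts]]] := loc_common_denominator primeP (f := fun j => j / k) ks.
have tkJ : Defs.iinv D J (t / k).
  move=> y; rewrite JE => Gy; apply: (star_mul_integral fG) Gy => z; rewrite GE.
  apply: (gens_min (submod_scale _ D_submod)) => e se.
  by rewrite mulrAC -mulrA; exact: ts.
have Jk : J k by rewrite JE; apply: (star_sub fG); rewrite GE; exact: gens_mem.
apply: Pt; have -> : t = k * (t / k) by field_nz.
by apply: XP; exact: iprod_mem.
Qed.

Notation SHI := (star_super_homog D star).

Lemma super_homog_fractional I : SHI I -> fractional D I. Proof. by case=> [[]]. Qed.
Lemma super_homog_integral I : SHI I -> subs I D. Proof. by case=> _ [_ [[]]]. Qed.

(* Otherwise [B B^-1] would lie in [M]. *)
Lemma star_invertible_generator_witness s M : (exists y, gens s y /\ y != 0) -> maxI M ->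
  star_invertible D star (star (gens s)) ->
  exists g u, g \in s /\ Defs.iinv D (star (gens s)) u /\ ~ M (u * g).
Proof.
move=> s0 maxM [fB BB']; have fG := gens_fractional s0.
have subM := prime_submod (maximal_prime maxM).
apply: NNPP => nug.
have BB'M : subs (iprod D (star (gens s)) (Defs.iinv D (star (gens s)))) M.
  apply: gen_min => // z [a [b [Ba [B'b ->]]]].
  rewrite mulrC; apply: (star_mul_sub fG (maximal_is_star_ideal maxM)) Ba => y.
  apply: (gens_min (submod_scale b subM)) => e se.
  by apply: NNPP => Mbe; apply: nug; exists e, b.
have := star_ideal_sub (iprod_fractional fB (iinv_fractional fB)) (maximal_is_star_ideal maxM) BB'M.
by rewrite BB' => /(_ 1 memD1); exact: maximal_not1.
Qed.

(* Apply the witness to [B = (d, I)^*]: its generator [g] generates [B] in D_M. *)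
Lemma super_homog_loc_dichotomy I M d : SHI I -> maxI M -> D d -> d != 0 ->
  (exists h t r, h != 0 /\ I h /\ loc_divides M h I /\
      D t /\ ~ M t /\ D r /\ t * d = h * r) \/ loc_divides M d I.
Proof.
move=> [idI [[J [[s JE] [J0 IE]]] [_ [invI _]]]] maxM Dd d0.
have primeM := maximal_prime maxM.
have ds0 : exists y, gens (d :: s) y /\ y != 0.
  by exists d; split => //; apply: gens_mem; exact: mem_head.
have fG := gens_fractional ds0.
pose B := star (gens (d :: s)).
have fJ : fractional D J by apply: fin_gen_fractional => //; exists s.
have IB : subs I B.
  rewrite IE; apply: star_mono => //; rewrite JE; apply: gens_subset => e se.
  by rewrite in_cons se orbT.
have invB : star_invertible D star B.
  apply: invI IB; first exact: star_star_ideal.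
  by exists (gens (d :: s)); split; first by exists (d :: s).
have [g [u [sg [uB' Mug]]]] := star_invertible_generator_witness ds0 maxM invB.
have ug0 : u * g != 0 := prime_neq0 primeM Mug.
have u0 : u != 0 by apply: contraNneq ug0 => ->; rewrite mul0r.
have g0 : g != 0 by apply: contraNneq ug0 => ->; rewrite mulr0.
have gB : loc_divides M g B.
  move=> z Bz; have -> : z / g = (u * z) / (u * g) by field_nz.
  by apply: loc_div => //; apply: uB'; [|apply: star_sub => //; exact: gens_mem].
move: sg; rewrite in_cons => /orP [/eqP gd|sg].
  by right => z Iz; rewrite -gd; apply: gB; exact: IB.
left; exists g, (u * g), (u * d); split => //.
split; first by rewrite IE; apply: star_sub => //; rewrite JE; exact: gens_mem.
split; first by move=> z Iz; apply: gB; exact: IB.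
split; first by apply: uB'; apply: star_sub => //; apply: gens_mem; rewrite in_cons sg orbT.
split => //; split; last by ring.
by apply: uB'; apply: star_sub => //; apply: gens_mem; exact: mem_head.
Qed.

Lemma iprods_loc_dichotomy M (ls : seq (kset K)) : maxI M -> (forall I, List.In I ls -> SHI I) ->
  forall d, D d -> (exists s, D s /\ ~ M s /\ iprods ls (s * d)) \/
                   (d != 0 /\ loc_divides M d (iprods ls)).
Proof.
move=> maxM; have primeM := maximal_prime maxM.
elim: ls => [|I ls IH] lsSH d Dd.
  by left; exists 1; split; [exact: memD1|split; [exact: maximal_not1|rewrite mul1r]].
have lsSH' J : List.In J ls -> SHI J by move=> lsJ; apply: lsSH; right.
have SHI_I : SHI I by apply: lsSH; left.
have [->|d0] := eqVneq d 0.
  left; exists 1; split; first exact: memD1.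
  by split; [exact: maximal_not1|rewrite mulr0; exact: (submod0 (gen_submod _))].
have lsD : subs (iprods ls) D by apply: iprods_integral => J /lsSH'; exact: super_homog_integral.
case: (super_homog_loc_dichotomy SHI_I maxM Dd d0)
  => [[h [t [r [h0 [Ih [hI [Dt [Mt [Dr tdE]]]]]]]]]|dI].
  case: (IH lsSH' r Dr) => [[s [Ds [Ms lsr]]]|[r0 rls]].
    left; exists (s * t); split; first exact: memDM.
    split; first exact: prime_notM.
    have -> : s * t * d = h * (s * r) by rewrite -mulrA tdE; ring.
    exact: iprod_mem.
  right; split => // z /(loc_dividesM primeM h0 r0 hI rls) lz.
  have t0 := prime_neq0 primeM Mt.
  have -> : z / d = z / (h * r) * t by rewrite -tdE; field_nz.
  by apply: (loc_mul primeM) lz _; exact: loc_D.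
right; split => // z.
have := loc_dividesM primeM d0 (oner_neq0 _) dI (loc_divides_integral primeM lsD).
by rewrite mulr1; apply.
Qed.

Lemma super_SH_valuation M : star_super_SH D star -> maxI M -> valuation_domain (localization D M).
Proof.
move=> SH maxM z z0; have primeM := maximal_prime maxM.
have [a [b [Da [Db [b0 zE]]]]] := quotD z.
have a0 : a != 0 by apply: contraNneq z0 => a0; rewrite zE a0 mul0r.
case: (classic (D b^-1)) => Dbi; first by left; rewrite zE; apply: (loc_D primeM); exact: memDM.
have [ls [lsSH bE]] := SH b Db b0 Dbi.
have fls : fractional D (iprods ls).
  by apply: iprods_fractional => I /lsSH; exact: super_homog_fractional.
case: (iprods_loc_dichotomy maxM lsSH Da) => [[s [Ds [Ms lssa]]]|[_ als]].
  have : prin D b (s * a) by rewrite bE; exact: star_sub.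
  move=> [e [De saE]]; left; have s0 := prime_neq0 primeM Ms.
  have aE : a = e * b / s by rewrite -saE; field_nz.
  have -> : z = e / s by rewrite zE aE; field_nz.
  exact: loc_div.
right; have -> : z^-1 = b / a by rewrite zE invf_div.
by apply: (star_loc_divides primeM a0 fls als); rewrite -/(star_product D star ls) -bE;
  exact: prin_self.
Qed.

Lemma star_gens_between sI sr I R : (exists y, gens sI y /\ y != 0) -> I = star (gens sI) ->
  maxI R -> subs I R -> (forall e, e \in sr -> R e) ->
  let A := star (gens (sI ++ sr)) in
  star_ideal D star A /\ finite_type D star A /\ proper_integral D A /\
  subs I A /\ subs (gens sr) A.
Proof.
move=> sI0 IE maxR IR srR A.
have nz : exists y, gens (sI ++ sr) y /\ y != 0.
  by case: sI0 => y [sIy y0]; exists y; split => //; apply: gens_subset sIy => e se;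
    rewrite mem_cat se.
have fG := gens_fractional nz.
have GR : subs (gens (sI ++ sr)) R.
  apply: gens_min; first exact: fractional_submod (maximal_fractional maxR).
  move=> e; rewrite mem_cat => /orP [se|/srR //].
  by apply: IR; rewrite IE; apply: star_sub; [exact: gens_fractional|exact: gens_mem].
have AR : subs A R := star_ideal_sub fG (maximal_is_star_ideal maxR) GR.
split; first exact: star_star_ideal.
split; first by exists (gens (sI ++ sr)); split; [exists (sI ++ sr)|].
split.
  split; first by move=> z /AR; exact: maximal_integral.
  by move=> AE; apply: (maximal_not1 maxR); apply: AR; rewrite AE; exact: memD1.
split.
  rewrite IE; apply: star_mono; [exact: gens_fractional|done|].
  by apply: gens_subset => e se; rewrite mem_cat se.
move=> z srz; apply: star_sub => //; apply: gens_subset srz => e se.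
by rewrite mem_cat se orbT.
Qed.

(* If [P <> Q], then [(P + Q)^* = D], so finitely many [p_i + q_i = g_i] generate an ideal
   whose star contains [1]; enlarging [I] by the [p_i] resp. the [q_i] violates condition (2). *)
Lemma super_homog_unique_maximal I P Q : SHI I -> maxI P -> maxI Q -> subs I P -> subs I Q -> P = Q.
Proof.
move=> SHI_I maxP maxQ IP IQ; apply: NNPP => PQ.
move: (SHI_I) => [idI [[J [[sI JE] [J0 IE]]] [_ [_ sumI]]]].
have fP := maximal_fractional maxP; have fQ := maximal_fractional maxQ.
have fS : fractional D (isum P Q) by exact: isum_fractional.
have S1 : star (isum P Q) 1.
  apply: maximal_star_isum1 => //; first exact: maximal_integral.
  move=> QP; apply: PQ; apply: (maximal_eq maxQ (maximal_is_star_ideal maxP)) QP.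
  - exact: maximal_integral.
  - exact: maximal_not1.
move: S1; rewrite (fcD fS) => -[G [[s GE] [G0 [GS G1]]]].
have [sp [sq [spP [sqQ sE]]]] :=
  decomp_isum (s := s) (fun e se => GS e (eq_ind_r (fun G => G e) (gens_mem se) GE)).
subst J.
have [idA [ftA [piA [IA spA]]]] := star_gens_between J0 IE maxP IP spP.
have [idB [ftB [piB [IB sqB]]]] := star_gens_between J0 IE maxQ IQ sqQ.
apply: (sumI _ _ idA ftA piA IA idB ftB piB IB).
have fAB : fractional D (isum (star (gens (sI ++ sp))) (star (gens (sI ++ sq)))).
  by apply: isum_fractional; [case: idA|case: idB].
apply: submod_eqD; first exact: fractional_submod (star_fractional fAB).
  by apply: star_integral => //; apply: isum_integral; [case: piA|case: piB].
have fG : fractional D G by apply: fin_gen_fractional => //; exists s.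
apply: (star_mono fG fAB) G1; rewrite GE.
apply: gens_min; first by apply: isum_submod; apply: fractional_submod; [case: idA|case: idB].
move=> e /sE [a [b [spa [sqb ->]]]].
by exists a, b; split; [apply: spA; exact: gens_mem|split => //; apply: sqB; exact: gens_mem].
Qed.

Lemma super_homog_factor_sub_prime x R (ls : seq (kset K)) : prime_ideal R ->
  (forall I, List.In I ls -> SHI I) -> prin D x = star_product D star ls -> R x ->
  exists I, List.In I ls /\ subs I R.
Proof.
move=> primeR lsSH xE Rx; apply: prime_iprods => //; first by move=> I /lsSH;
  exact: super_homog_integral.
have fls : fractional D (iprods ls) by apply: iprods_fractional => I /lsSH;
  exact: super_homog_fractional.
move=> z lsz; have : prin D x z by rewrite xE; exact: star_sub.
by move=> [d [Dd ->]]; exact: (submodZ (prime_submod primeR)).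
Qed.

Lemma super_homog_maximal_list (ls : seq (kset K)) : (forall I, List.In I ls -> SHI I) ->
  exists L : seq (kset K), forall P, maxI P -> (exists I, List.In I ls /\ subs I P) -> List.In P L.
Proof.
elim: ls => [|I ls IH] lsSH; first by exists [::] => P _ [I [[] _]].
have [L LP] := IH (fun J lsJ => lsSH J (or_intror lsJ)).
have SHI_I := lsSH I (or_introl erefl).
case: (classic (exists P0, maxI P0 /\ subs I P0)) => [[P0 [maxP0 IP0]]|noP].
  exists (P0 :: L) => P maxP [J [[<-|lsJ] JP]]; last by right; apply: LP => //; exists J.
  by left; exact: (super_homog_unique_maximal SHI_I maxP0 maxP IP0 JP).
exists L => P maxP [J [[<-|lsJ] JP]]; last by apply: LP => //; exists J.
by case: noP; exists P.
Qed.

Lemma super_SH_IRKT : star_super_SH D star -> star_IRKT D star.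
Proof.
move=> SH; split; first by move=> P; exact: super_SH_valuation.
split.
  move=> x; split; last exact: mem_of_loc_maximal.
  by move=> Dx P /maximal_prime primeP; exact: loc_D.
split.
  move=> x Dx x0; case: (classic (D x^-1)) => Dxi.
    by exists [::] => P /maximal_prime primeP; case/(prime_not_unit primeP x0 Dxi).
  have [ls [lsSH xE]] := SH x Dx x0 Dxi.
  have [L LP] := super_homog_maximal_list lsSH.
  exists L => P maxP Px; apply: LP => //.
  exact: (super_homog_factor_sub_prime (maximal_prime maxP) lsSH xE Px).
move=> P Q R maxP maxQ PQ [subR [[RD RneD] [[x [Rx x0]] primeR]]] RP RQ.
have primeR' : prime_ideal R by split => //; split => //; split => //; exact: submod_proper_not1.
have Dx : D x by exact: RD.
case: (classic (D x^-1)) => Dxi; first exact: (prime_not_unit primeR' x0 Dxi Rx).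
have [ls [lsSH xE]] := SH x Dx x0 Dxi.
have [I [lsI IR]] := super_homog_factor_sub_prime primeR' lsSH xE Rx.
apply: PQ; apply: (super_homog_unique_maximal (lsSH I lsI)) => // z /IR; [exact: RP|exact: RQ].
Qed.

(* Otherwise the radical of [x D_Q] in [D] would be a nonzero prime inside both [P] and [Q]. *)
Lemma IRKT_separating_element P Q x : star_IRKT D star -> maxI P -> maxI Q -> P <> Q ->
  D x -> x != 0 -> P x -> Q x -> exists y, D y /\ localization D Q (y / x) /\ ~ P y.
Proof.
move=> [val [_ [_ indep]]] maxP maxQ PQ Dx x0 Px Qx; apply: NNPP => noy.
have primeQ := maximal_prime maxQ.
apply: (indep P Q (loc_radical Q x)) => //.
- exact: (loc_radical_prime primeQ (val Q maxQ) Dx x0 Qx).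
- apply: loc_radical_sub_prime (maximal_prime maxP) _ => y Dy lyx.
  by apply: NNPP => Py; apply: noy; exists y.
- exact: (loc_radical_sub primeQ x0 Qx).
Qed.

Section HomogFactorization.
Hypothesis IRKT : star_IRKT D star.
Variables (x : K) (L : seq (kset K)).
Hypotheses (Dx : D x) (x0 : x != 0) (Dxi : ~ D x^-1).
Hypotheses (ndL : List.NoDup L) (LE : forall P, List.In P L <-> maxI P /\ P x).

Lemma maximal_of_list Q : List.In Q L -> maxI Q. Proof. by case/LE. Qed.
Lemma mem_of_list Q : List.In Q L -> Q x. Proof. by case/LE. Qed.

Definition separator Q P : K :=
  epsilon (inhabits 0) (fun y => D y /\ localization D Q (y / x) /\ (P <> Q -> ~ P y)).

Lemma separator_spec Q P : List.In Q L -> List.In P L ->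
  D (separator Q P) /\ localization D Q (separator Q P / x) /\ (P <> Q -> ~ P (separator Q P)).
Proof.
move=> LQ LP; suff : exists y, D y /\ localization D Q (y / x) /\ (P <> Q -> ~ P y).
  exact: epsilon_spec.
have maxQ := maximal_of_list LQ; have maxP := maximal_of_list LP.
case: (classic (P = Q)) => [PQ|PQ].
  exists x; split => //; split => //.
  by rewrite divff //; apply: (loc_D (maximal_prime maxQ)); exact: memD1.
have [y [Dy [lyx Py]]] :=
  IRKT_separating_element IRKT maxP maxQ PQ Dx x0 (mem_of_list LP) (mem_of_list LQ).
by exists y.
Qed.

Definition homog_gens Q := x :: map (separator Q) L.
Definition homog_factor Q := star (gens (homog_gens Q)).

Lemma homog_gens_fractional Q : fractional D (gens (homog_gens Q)).
Proof. by apply: gens_fractional; exists x; split => //; apply: gens_mem; exact: mem_head. Qed.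

Lemma mem_homog_gens Q e : List.In Q L -> e \in homog_gens Q -> D e /\ localization D Q (e / x).
Proof.
move=> LQ; rewrite in_cons => /orP [/eqP ->|].
  split => //; rewrite divff //; apply: (loc_D (maximal_prime (maximal_of_list LQ))); exact: memD1.
case/mem_map_In => P [LP ->]; have [Dy [ly _]] := separator_spec LQ LP.
by split.
Qed.

Lemma homog_x Q : homog_factor Q x.
Proof. by apply: star_sub; [exact: homog_gens_fractional|apply: gens_mem; exact: mem_head]. Qed.

Lemma homog_separator Q P : List.In P L -> homog_factor Q (separator Q P).
Proof.
move=> LP; apply: star_sub; first exact: homog_gens_fractional.
by apply: gens_mem; rewrite in_cons; apply/orP; right; apply/mem_map_In; exists P.
Qed.

Lemma homog_loc_divides Q : List.In Q L -> loc_divides Q x (homog_factor Q).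
Proof.
move=> LQ; have primeQ := maximal_prime (maximal_of_list LQ).
apply: star_loc_divides => //; first exact: homog_gens_fractional.
by apply: loc_divides_gen => // e /(mem_homog_gens LQ) [].
Qed.

Lemma homog_sub Q : List.In Q L -> subs (homog_factor Q) Q.
Proof.
move=> LQ; have maxQ := maximal_of_list LQ; have primeQ := maximal_prime maxQ.
apply: star_ideal_sub; [exact: homog_gens_fractional|exact: maximal_is_star_ideal|].
apply: gens_min; first exact: prime_submod.
move=> e /(mem_homog_gens LQ) [De le].
exact: (loc_divides_mem primeQ x0 (mem_of_list LQ) De le).
Qed.

(* A maximal star ideal above [homog_factor Q] contains [x], so it is in [L], and it contains
   [separator Q P] only if it is [Q]. *)
Lemma homog_proper_sub Q A : List.In Q L -> star_ideal D star A -> proper_integral D A ->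
  subs (homog_factor Q) A -> subs A Q.
Proof.
move=> LQ [fA AE] [AD AneD] QA.
have A1 : ~ star A 1 by rewrite AE; apply: submod_proper_not1 => //; exact: fractional_submod.
have [P [maxP AP]] := exists_maximal fA AD A1.
have LP : List.In P L by apply/LE; split => //; apply: AP; apply: QA; exact: homog_x.
case: (classic (P = Q)) => [<- //|PQ].
have [_ [_ Psep]] := separator_spec LQ LP.
by case: (Psep PQ); apply: AP; apply: QA; exact: homog_separator.
Qed.

Lemma homog_super_homog Q : List.In Q L -> SHI (homog_factor Q).
Proof.
move=> LQ; have maxQ := maximal_of_list LQ.
have idQ : star_ideal D star (homog_factor Q) by exact: star_star_ideal (homog_gens_fractional Q).
split => //; split.
  exists (gens (homog_gens Q)); split; first by exists (homog_gens Q).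
  by split => //; exists x; split => //; apply: gens_mem; exact: mem_head.
split.
  split; first by move=> z /(homog_sub LQ); exact: maximal_integral.
  by move=> QE; apply: (maximal_not1 maxQ); apply: (homog_sub LQ); rewrite QE; exact: memD1.
split; first by move=> J idJ ftJ _; case: IRKT => val _; exact: finite_type_star_invertible.
move=> A B idA _ piA QA idB _ piB QB ABE.
have AQ := homog_proper_sub LQ idA piA QA; have BQ := homog_proper_sub LQ idB piB QB.
have fAB : fractional D (isum A B) by apply: isum_fractional; [case: idA|case: idB].
have ABQ : subs (isum A B) Q.
  move=> z [a [b [Aa [Bb ->]]]].
  by apply: submodD; [exact: fractional_submod (maximal_fractional maxQ)|exact: AQ|exact: BQ].
have := star_ideal_sub fAB (maximal_is_star_ideal maxQ) ABQ; rewrite ABE.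
by move=> /(_ 1 memD1); exact: maximal_not1.
Qed.

Lemma homog_product_fractional : fractional D (iprods (map homog_factor L)).
Proof.
apply: iprods_fractional => I /In_map_iff [Q [LQ ->]].
exact: super_homog_fractional (homog_super_homog LQ).
Qed.

Lemma homog_integral Q : List.In Q L -> subs (homog_factor Q) D.
Proof. by move=> LQ; exact: super_homog_integral (homog_super_homog LQ). Qed.

(* Locally at a maximal [P], every factor is integral except the one at [P], which is
   divisible by [x]. *)
Lemma homog_product_sub : subs (star (iprods (map homog_factor L))) (prin D x).
Proof.
move=> z Fz; suff Dzx : D (z / x) by exists (z / x); split => //; field_nz.
apply: mem_of_loc_maximal => P maxP; have primeP := maximal_prime maxP.
pose c Q := if boolp.pselect (Q = P) then x else 1.
have cF : loc_divides P (foldr (fun Q acc => c Q * acc) 1 L) (iprods (map homog_factor L)).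
  apply: loc_divides_iprods => // Q LQ; rewrite /c; case: boolp.pselect => [QP|_] /=.
    by subst Q; split => //; exact: homog_loc_divides.
  by split; [exact: oner_neq0|exact: loc_divides_integral (homog_integral LQ)].
have cQ Q : Q <> P -> c Q = 1 by rewrite /c; case: boolp.pselect.
case: (classic (List.In P L)) => LP.
  have [r [-> cE]] : exists r, r = 1 /\ foldr (fun Q acc => c Q * acc) 1 L = c P * r.
    apply: (foldr_mul_NoDup (S := fun r => r = 1)) => //; first by move=> a b -> ->; rewrite mulr1.
    by move=> Q _; exact: cQ.
  have cPx : c P = x by rewrite /c; case: boolp.pselect.
  rewrite cE mulr1 cPx in cF.
  exact: star_loc_divides homog_product_fractional cF z Fz.
have c1 : foldr (fun Q acc => c Q * acc) 1 L = 1.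
  apply: (foldr_mul_closed (S := fun r => r = 1)) => // [a b -> ->|Q LQ]; first by rewrite mulr1.
  by apply: cQ => QP; apply: LP; rewrite -QP.
rewrite c1 in cF.
have Px : ~ P x by move=> Px; apply: LP; apply/LE.
have := star_loc_divides primeP (oner_neq0 _) homog_product_fractional cF Fz.
rewrite divr1 => lz; rewrite -[z / x]/(z * x^-1).
by apply: (loc_mul primeP lz); exact: loc_inv.
Qed.

(* At [P] in [L], take [x] from the factor at [P] and the separators [separator Q P] from
   the others; away from [L], take [x] from every factor. *)
Lemma homog_product_witness P : maxI P -> exists w, iprods (map homog_factor L) w /\ ~ P (x^-1 * w).
Proof.
move=> maxP; have primeP := maximal_prime maxP.
have SM a b : D a /\ ~ P a -> D b /\ ~ P b -> D (a * b) /\ ~ P (a * b).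
  by move=> [Da Pa] [Db Pb]; split; [exact: memDM|exact: prime_notM].
case: (classic (List.In P L)) => LP.
  pose f Q := if boolp.pselect (Q = P) then x else separator Q P.
  have fL Q : List.In Q L -> homog_factor Q (f Q).
    by move=> LQ; rewrite /f; case: boolp.pselect => _ /=; [exact: homog_x|exact: homog_separator].
  have fQ Q : List.In Q L -> Q <> P -> D (f Q) /\ ~ P (f Q).
    move=> LQ QP; rewrite /f; case: boolp.pselect => [/QP //|_] /=.
    have [Dy [_ Py]] := separator_spec LQ LP; split => //.
    by apply: Py => PQ; apply: QP; rewrite PQ.
  have [r [[Dr Pr] fE]] := foldr_mul_NoDup (S := fun r => D r /\ ~ P r) (f := f)
    (conj memD1 (prime_not1 primeP)) SM ndL LP fQ.
  have fPx : f P = x by rewrite /f; case: boolp.pselect.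
  exists (foldr (fun Q acc => f Q * acc) 1 L); split; first exact: iprods_mem.
  by rewrite fE fPx; have -> : x^-1 * (x * r) = r by field_nz.
have Px : ~ P x by move=> Px; apply: LP; apply/LE.
have [n xnE] : exists n, foldr (fun _ acc => x * acc) 1 L = x ^+ n.
  apply: (foldr_mul_closed (S := fun r => exists n, r = x ^+ n)) => [|a b [m ->] [n ->]|].
  - by exists 0%N.
  - by exists (m + n)%N; rewrite exprD.
  - by exists 1%N.
exists (x ^+ n); split; first by rewrite -xnE; apply: iprods_mem => Q _; exact: homog_x.
case: n {xnE} => [|n]; first by rewrite expr0 mulr1 => /(prime_integral primeP).
by rewrite exprS mulKf //; exact: prime_notX.
Qed.

Lemma homog_product_x : star (iprods (map homog_factor L)) x.
Proof.
apply: NNPP => Fx.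
have fF := homog_product_fractional.
have xi0 : x^-1 != 0 by rewrite invr_neq0.
pose Y := mulset x^-1 (iprods (map homog_factor L)).
have YD : subs Y D.
  move=> w [z [Fz ->]]; have [d [Dd ->]] := homog_product_sub (star_sub fF Fz).
  by have -> : x^-1 * (d * x) = d by field_nz.
have Y1 : ~ star Y 1.
  rewrite star_mulset // => -[z [Fz zE]]; apply: Fx.
  by have -> : x = z by rewrite -[x]mulr1 zE; field_nz.
have [P [maxP YP]] := exists_maximal (mulset_fractional xi0 fF) YD Y1.
have [w [Fw Pw]] := homog_product_witness maxP.
by apply: Pw; apply: YP; exists w.
Qed.

Lemma homog_factorization : prin D x = star_product D star (map homog_factor L).
Proof.
apply: kset_ext => [_ [d [Dd ->]]|]; last exact: homog_product_sub.
have subF := fractional_submod (star_fractional homog_product_fractional).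
exact: (submodZ subF Dd homog_product_x).
Qed.

End HomogFactorization.

Lemma IRKT_super_SH : star_IRKT D star -> star_super_SH D star.
Proof.
move=> IRKT x Dx x0 Dxi; case: (IRKT) => _ [_ [locfin _]].
have [L0 L0E] := locfin x Dx x0.
have [L [ndL LE]] := exists_NoDup_filter L0 (fun P => maxI P /\ P x).
have LE' P : List.In P L <-> maxI P /\ P x.
  by split => [/LE [_ //]|[maxP Px]]; apply/LE; split => //; exact: L0E.
exists (map (homog_factor x L) L); split; last exact: homog_factorization.
by move=> I /In_map_iff [Q [LQ ->]]; exact: homog_super_homog.
Qed.

Theorem super_SH_iff_IRKT : star_super_SH D star <-> star_IRKT D star.
Proof. by split; [exact: super_SH_IRKT|exact: IRKT_super_SH]. Qed.

End Star.
End Domain.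

Theorem propositionQ3 (K : fieldType) (D : kset K) (star : kset K -> kset K) :
  is_subring D -> is_quotient_field D ->
  star_operation D star -> finite_character D star ->
  (star_super_SH D star <-> star_IRKT D star).
Proof. by move=> subringD quotD starD fcD; exact: (super_SH_iff_IRKT subringD quotD starD fcD). Qed.
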